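(* Let $r\ge 1$ be an integer, let $A$ be the set of even non-negative integers and $B$ the set of odd non-negative integers. Then for every integer $n\ge r$, \[ g^{(r)}_A(n)=g^{(r)}_B(n)=2^{\lfloor \frac{r-1}{r}n\rfloor}. \]
   Context: An $r$-uniform hypergraph is a finite vertex set with a family of $r$-element subsets (hyperedges). A vertex is isolated if it lies in no hyperedge. Given a non-empty set $A$ of non-negative integers, a set $S$ of vertices is an $A$-transversal of an $r$-uniform hypergraph $\mathcal{H}$ if $|H\cap S|\in A$ for every hyperedge $H$. For $n\ge r$, $g^{(r)}_A(n)$ denotes the maximum number of $A$-transversals in an $r$-uniform hypergraph on $n$ vertices with no isolated vertices. *)

(* Defs.v *)
From mathcomp Require Import all_boot.

Set Implicit Arguments.
Unset Strict Implicit.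
Unset Printing Implicit Defensive.

(* A hypergraph on the vertex set T is its set E of hyperedges. *)

Definition uniform (T : finType) (r : nat) (E : {set {set T}}) : bool :=
  [forall H in E, #|H| == r].

Definition isolated (T : finType) (E : {set {set T}}) (v : T) : bool :=
  ~~ [exists H in E, v \in H].

Definition no_isolated (T : finType) (E : {set {set T}}) : bool :=
  [forall v : T, ~~ isolated E v].

Definition is_Atransversal (T : finType) (A : {pred nat}) (E : {set {set T}})
    (S : {set T}) : bool :=
  [forall H in E, #|H :&: S| \in A].

Definition transversals (T : finType) (A : {pred nat}) (E : {set {set T}})
    : {set {set T}} :=
  [set S | is_Atransversal A E S].

(* For 1 <= r <= n the range of the maximum is nonempty (all r-subsets form an
   admissible hypergraph), so the default value 0 of \max plays no role. *)
Definition g (r : nat) (A : {pred nat}) (n : nat) : nat :=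
  \max_(E : {set {set 'I_n}} | uniform r E && no_isolated E)
     #|transversals A E|.

Definition evens : {pred nat} := [pred k | ~~ odd k].
Definition odds : {pred nat} := [pred k | odd k].

(* Main.v *)
Require Import Defs.
From mathcomp Require Import all_boot.
From mathcomp Require Import zify.

Set Implicit Arguments.
Unset Strict Implicit.
Unset Printing Implicit Defensive.

(** Over F_2 the transversals are the solutions of one linear equation per
    hyperedge.  Put k = ceil(n / r), so that n - k = floor((r - 1) n / r).

    Upper bound: fewer than k hyperedges never cover all the vertices, so one
    can greedily pick k hyperedges, each containing a vertex missed by the
    previous ones.  The resulting k equations are in echelon form, so a
    transversal is determined by its trace outside the k chosen vertices.

    Lower bound: cut the vertex set into consecutive blocks of length r, the
    last block being shifted back so as to end at the last vertex.  Each of the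
    k blocks has a private vertex, with which its parity can be adjusted freely
    after the rest of the set has been chosen. *)

Section ParityTransversals.

Variables (T : finType) (A : {pred nat}) (b : bool).
Hypothesis parityA : forall k, (k \in A) = (odd k == b).

Lemma transversal_odd (E : {set {set T}}) (S H : {set T}) :
  S \in transversals A E -> H \in E -> odd #|H :&: S| = b.
Proof.
by rewrite inE => /forall_inP HS /HS; rewrite parityA => /eqP.
Qed.

Lemma no_isolatedP (E : {set {set T}}) :
  reflect (forall v, exists2 H, H \in E & v \in H) (no_isolated E).
Proof.
apply: (iffP forallP) => h v; first by have /negPn/exists_inP := h v.
by apply/negPn/exists_inP.
Qed.

(** One equation with a single unknown: away from [v] the two intersections with [H] coincide, so
    their common parity decides whether [v] belongs. *)
Lemma odd_cardI_inj (S S' H : {set T}) (v : T) :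
    v \in H -> odd #|H :&: S| = odd #|H :&: S'| ->
    {in H :\ v, S =i S'} ->
  (v \in S) = (v \in S').
Proof.
move=> vH; rewrite (cardsD1 v (H :&: S)) (cardsD1 v (H :&: S')) !in_setI vH /=.
move=> eqodd eqS; suff e : (H :&: S) :\ v = (H :&: S') :\ v.
  by move: eqodd; rewrite e !oddD !oddb => /addIb.
apply/setP=> x; rewrite !inE; case: (eqVneq x v) => //= xv.
by case: (boolP (x \in H)) => //= xH; apply: eqS; rewrite !inE xv.
Qed.

(* [U] is the union of the [k] hyperedges picked so far and [V] consists of the
   vertex that each of them adds to the previous ones. *)
Lemma echelon_vertices (r : nat) (E : {set {set T}}) (k : nat) :
    uniform r E -> no_isolated E -> k.-1 * r < #|T| ->
  exists U V : {set T},
    [/\ V \subset U, #|V| = k, #|U| <= k * r &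
        forall S S', S \in transversals A E -> S' \in transversals A E ->
          {in U :\: V, S =i S'} -> {in U, S =i S'}].
Proof.
move=> /forall_inP unifE /no_isolatedP covE; elim: k => [|k IHk] /= ltk.
  exists set0, set0; split; rewrite ?cards0 // => S S' _ _ _ x.
  by rewrite inE.
have [|U [V [sVU cV cU detU]]] := IHk.
  by apply: leq_ltn_trans ltk; rewrite leq_mul2r leq_pred orbT.
have [v vU] : exists v, v \notin U.
  have : 0 < #|~: U| by rewrite cardsCs setCK subn_gt0 (leq_ltn_trans cU).
  by case/card_gt0P=> v; rewrite inE; exists v.
have [H HE vH] := covE v.
have vV : v \notin V by apply: contra vU; apply: (subsetP sVU).
exists (U :|: H), (v |: V); split.
- apply/subsetP=> x; rewrite !inE => /orP[/eqP->|/(subsetP sVU) ->] //.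
  by rewrite vH orbT.
- by rewrite cardsU1 vV cV.
- rewrite mulSn addnC; apply: leq_trans (leq_card_setU _ _) _.
  by rewrite (eqP (unifE _ HE)) leq_add2r.
move=> S S' tS tS' eqS.
(* Back substitution: since [v] lies outside [U], the induction hypothesis first settles [U]; then
   [v] is the only unknown left in the equation of [H]. *)
have eqU : {in U, S =i S'}.
  apply: detU => // x; rewrite !inE => /andP[xV xU]; apply: eqS.
  by rewrite !inE xU (negPf xV) !orbF andbT; apply: contraNneq vU => <-.
have eqUv x : x \in U :|: H -> x != v -> (x \in S) = (x \in S').
  move=> xUH xv; case: (boolP (x \in U)) => [/eqU //|xU].
  apply: eqS; rewrite inE xUH andbT !inE negb_or xv.
  by apply: contra xU; apply: (subsetP sVU).
move=> x xUH; have [->|/eqUv->//] := eqVneq x v.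
apply: (@odd_cardI_inj _ _ H) => //.
  by rewrite (transversal_odd tS HE) (transversal_odd tS' HE).
by move=> y; rewrite !inE => /andP[yv yH]; apply: eqUv; rewrite // inE yH orbT.
Qed.

Lemma card_transversals_le (r : nat) (E : {set {set T}}) (k : nat) :
    uniform r E -> no_isolated E -> k.-1 * r < #|T| ->
  #|transversals A E| <= 2 ^ (#|T| - k).
Proof.
move=> unifE covE ltk.
have [U [V [sVU cV _ detU]]] := echelon_vertices unifE covE ltk.
have -> : #|T| - k = #|~: V| by rewrite cardsCs setCK cV.
rewrite -card_powerset.
rewrite -(card_in_imset (f := fun S => S :\: V) (D := transversals A E)).
  apply: subset_leq_card; apply/subsetP=> _ /imsetP[S _ ->].
  by rewrite powersetE setDE subsetIr.
move=> S S' tS tS' /setP eqSV.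
have eqS x : x \notin V -> (x \in S) = (x \in S').
  by move=> xV; have := eqSV x; rewrite !inE xV.
apply/setP=> x; case: (boolP (x \in V)) => [/(subsetP sVU)|/eqS//].
by apply: detU => // y; rewrite inE => /andP[/eqS].
Qed.

Lemma card_transversals_ge (k : nat) (f : 'I_k -> {set T}) (p : 'I_k -> T) :
    (forall i j, (p i \in f j) = (i == j)) ->
  2 ^ (#|T| - k) <= #|transversals A [set f i | i : 'I_k]|.
Proof.
move=> pf; set V := [set p i | i : 'I_k].
have pI : injective p by move=> i j eqp; apply/eqP; rewrite -pf eqp pf.
have -> : #|T| - k = #|~: V|.
  by rewrite cardsCs setCK card_imset // card_ord.
(* Adding [p i] flips the parity on [f i] and on no other hyperedge, so all wrong parities can be
   repaired at once. Only vertices of [V] are added, hence [W] can be recovered. *)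
pose fix_parity (W : {set T}) :=
  W :|: [set p i | i : 'I_k & odd #|f i :&: W| != b].
have fixD (W : {set T}) : W \subset ~: V -> fix_parity W :\: V = W.
  move=> /subsetP sW; apply/setP=> x; rewrite !inE.
  case: (boolP (x \in W)) => [/sW|_] /=; first by rewrite inE => ->.
  by apply/andP=> -[+ /imsetP[i _ xi]]; rewrite xi imset_f.
rewrite -card_powerset.
rewrite -(card_in_imset (f := fix_parity) (D := powerset (~: V))); last first.
  move=> W W'; rewrite !powersetE => sW sW' eqW.
  by rewrite -(fixD _ sW) -(fixD _ sW') eqW.
apply: subset_leq_card; apply/subsetP=> _ /imsetP[W + ->].
rewrite powersetE => sW; rewrite inE; apply/forall_inP=> _ /imsetP[i _ ->].
have piW : p i \notin W.
  by apply/negP=> /(subsetP sW); rewrite inE imset_f.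
rewrite parityA (cardsD1 (p i)).
have -> : (f i :&: fix_parity W) :\ p i = f i :&: W.
  apply/setP=> x; rewrite !inE.
  case: (eqVneq x (p i)) => [->|xpi] /=; first by rewrite (negPf piW) andbF.
  case: (boolP (x \in f i)) => //= xfi.
  suff /negbTE-> : x \notin [set p i | i : 'I_k & odd #|f i :&: W| != b].
    by rewrite orbF.
  apply/negP=> /imsetP[j _ xj]; move: xfi xpi.
  by rewrite xj pf => /eqP->; rewrite eqxx.
rewrite !inE pf eqxx (negPf piW) /= mem_imset // inE oddD oddb.
by case: (odd _); case: (b).
Qed.

End ParityTransversals.

Lemma card_ord_interval (n s r : nat) :
  s + r <= n -> #|[set x : 'I_n | s <= x < s + r]| = r.
Proof.
move=> le_n; rewrite -[RHS]card_ord.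
have lt_n (i : 'I_r) : s + i < n by have := ltn_ord i; lia.
rewrite -(card_imset (f := fun i => Ordinal (lt_n i))); last first.
  by move=> i j [/addnI/val_inj].
apply: eq_card => x; rewrite inE; apply/idP/imsetP => [/andP[sx xs]|[i _ ->]].
  have lt_r : x - s < r by lia.
  by exists (Ordinal lt_r) => //; apply: val_inj => /=; lia.
by have := ltn_ord i; rewrite /=; lia.
Qed.

Lemma consecutive_blocks (r n : nat) :
    0 < r -> r <= n ->
  exists (f : 'I_(n.-1 %/ r).+1 -> {set 'I_n})
         (p : 'I_(n.-1 %/ r).+1 -> 'I_n),
    [/\ forall i j, (p i \in f j) = (i == j),
        uniform r [set f i | i : 'I_(n.-1 %/ r).+1] &
        no_isolated [set f i | i : 'I_(n.-1 %/ r).+1]].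
Proof.
move=> r0 rn; set k := (n.-1 %/ r).+1.
have lek (i : 'I_k) : i * r <= n.-1.
  by rewrite -leq_divRL // -ltnS.
pose start (i : 'I_k) := minn (i * r) (n - r).
(* The private vertex is the first one of an unshifted block; a shifted block may overlap its
   predecessor at the front, so its last vertex [n.-1] is taken instead. *)
have lt_p (i : 'I_k) : (if i * r <= n - r then i * r else n.-1) < n.
  by have := lek i; case: ifP; lia.
exists (fun i => [set x : 'I_n | start i <= x < start i + r]).
exists (fun i => Ordinal (lt_p i)); split.
- move=> i j; rewrite inE /= /start -val_eqE /=.
  have := lek i; have := lek j; case: (ltngtP i j) => [ij|ji|->].
  + by have : i.+1 * r <= j * r; [rewrite leq_mul2r ij orbT|case: ifP; lia].
  + by have : j.+1 * r <= i * r; [rewrite leq_mul2r ji orbT|case: ifP; lia].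
  + by case: ifP; lia.
- apply/forall_inP=> _ /imsetP[i _ ->]; apply/eqP/card_ord_interval.
  by rewrite /start; lia.
apply/no_isolatedP=> v.
(* Block [v %/ r] contains [v] even if shifted, because it then extends up to the last vertex. *)
have lt_k : v %/ r < k.
  by rewrite /k ltnS leq_div2r //; have := ltn_ord v; lia.
exists [set x : 'I_n | start (Ordinal lt_k) <= x < start (Ordinal lt_k) + r].
  exact: imset_f.
rewrite inE /start /=.
have := divn_eq v r; have := ltn_pmod v r0; have := ltn_ord v; lia.
Qed.

Lemma sub_ceil_div (r n : nat) :
  0 < r -> r <= n -> n - (n.-1 %/ r).+1 = ((r - 1) * n) %/ r.
Proof.
move=> r0 rn; have := divn_eq n.-1 r; have := ltn_pmod n.-1 r0.
move: (n.-1 %/ r) (n.-1 %% r) => q s ltsr def_n.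
(* This gives [q.+1 <= n], so the subtraction [n - q.+1] below is not truncated. *)
have le_q : q <= q * r by rewrite leq_pmulr.
have -> : (r - 1) * n = (n - q.+1) * r + (r - s.+1) by nia.
by rewrite divnMDl // divn_small; lia.
Qed.

(** Both parities are handled together: [b] is the common right-hand side of all the equations over
    F_2, and the count does not depend on it. *)
Lemma g_parity (r n : nat) (A : {pred nat}) (b : bool) :
    (forall k, (k \in A) = (odd k == b)) -> 0 < r -> r <= n ->
  g r A n = 2 ^ (((r - 1) * n) %/ r).
Proof.
move=> parityA r0 rn; rewrite -sub_ceil_div //; apply/eqP.
rewrite eqn_leq; apply/andP; split.
  apply/bigmax_leqP=> E /andP[unifE covE].
  rewrite -[n in n - _]card_ord.
  apply: (card_transversals_le parityA unifE covE).
  by rewrite card_ord /=; have := leq_divM n.-1 r; lia.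
have [f [p [pf unifE covE]]] := consecutive_blocks r0 rn.
rewrite -[n in n - _]card_ord.
apply: leq_trans (card_transversals_ge parityA pf) _.
by apply: leq_bigmax_cond; rewrite unifE covE.
Qed.

Theorem theorem4 (r : nat) (hr : 1 <= r) (n : nat) (hn : r <= n) :
  g r evens n = 2 ^ (((r - 1) * n) %/ r) /\
  g r odds n = 2 ^ (((r - 1) * n) %/ r).
Proof.
split.
- by apply: (@g_parity _ _ _ false) => // k; rewrite inE eqbF_neg.
- by apply: (@g_parity _ _ _ true) => // k; rewrite inE eqb_id.
Qed.
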